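(* For each $N\ge 1$, let $J=\{J_{i,j}\}_{1\le i,j\le N}$ and $Y=\{Y_{i,j}\}_{1\le i,j\le N}$ be two independent sequences of independent real random variables such that, for every $i,j$, $\mathbb{E}[J_{i,j}]=\mathbb{E}[Y_{i,j}]=0$ and $\mathbb{E}[J_{i,j}^2]=\mathbb{E}[Y_{i,j}^2]=1$. Set $\gamma:=\max\{\mathbb{E}[|J_{i,j}|^3],\ \mathbb{E}[|Y_{i,j}|^3] : 1\le i,j\le N\}$, where $\gamma$ may be infinite. For a matrix $X=\{X_{i,j}\}_{1\le i,j\le N}$ and $\eta\in\{0,1\}^N$ let $H(X,\eta)=\frac{1}{\sqrt N}\sum_{1\le i,j\le N}X_{i,j}\eta_i\eta_j$. Then, as $N\to\infty$, $$\frac1N\Big|\mathbb{E}\big[\min_{\eta}H(J,\eta)\big]-\mathbb{E}\big[\min_{\eta}H(Y,\eta)\big]\Big|\to 0,\qquad \frac1N\Big|\mathbb{E}\big[\max_{\eta}H(J,\eta)\big]-\mathbb{E}\big[\max_{\eta}H(Y,\eta)\big]\Big|\to 0,$$ where the minima and maxima are over $\eta\in\{0,1\}^N$. If furthermore $\gamma<\infty$, then $$\frac1N\Big|\mathbb{E}\big[\min_{\eta}H(J,\eta)\big]-\mathbb{E}\big[\min_{\eta}H(Y,\eta)\big]\Big|\le C N^{-1/6},\qquad \frac1N\Big|\mathbb{E}\big[\max_{\eta}H(J,\eta)\big]-\mathbb{E}\big[\max_{\eta}H(Y,\eta)\big]\Big|\le C N^{-1/6},$$ where $C$ is a constant depending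 only on $\gamma$.
   Context: The normalizing constant $1/\sqrt N$ in $H$ is chosen so that $\frac{1}{\sqrt N}\sum_{1\le i,j\le N}J_{i,j}$ has variance $N$.
   Formalization: The first two limits are proved assuming, for J and Y, that N^{-2} sum_{i,j} E[X_{ij}^2; |X_{ij}| > eps sqrt N] -> 0 for every eps > 0; without it they fail (J_{ij} = ±N with probability 1/(2N^2) each, else 0, against random signs). *)

(* Defs.v *)
From HB Require Import structures.
From mathcomp Require Export all_boot all_order all_algebra.
From mathcomp Require Export all_classical all_reals all_analysis.
Export Order.TTheory GRing.Theory Num.Theory.
Export numFieldNormedType.Exports.

Set Implicit Arguments.
Unset Strict Implicit.
Unset Printing Implicit Defensive.

Local Open Scope classical_set_scope.
Local Open Scope ring_scope.

(* Product rule over every (automatically finite) subfamily. *)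
Definition mutually_independent (R : realType) (d : measure_display)
    (T : measurableType d) (P : probability T R) (I : finType)
    (X : I -> {RV P >-> R}) : Prop :=
  forall (S : {set I}) (B : I -> set R),
    (forall i, measurable (B i)) ->
    P (\bigcap_(i in [set` S]) (X i @^-1` B i)) =
    (\big[*%E/1%E]_(i in S) P (X i @^-1` B i))%E.

Definition family_sigma_algebra (R : realType) (d : measure_display)
    (T : measurableType d) (P : probability T R) (I : finType)
    (X : I -> {RV P >-> R}) : set (set T) :=
  <<s \bigcup_(i in [set: I]) preimage_set_system [set: T] (X i) measurable >>.

Definition independent_families (R : realType) (d : measure_display)
    (T : measurableType d) (P : probability T R) (I : finType)
    (X Y : I -> {RV P >-> R}) : Prop :=
  forall E F : set T, family_sigma_algebra X E -> family_sigma_algebra Y F ->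
    P (E `&` F) = (P E * P F)%E.

Section couplings.
Variables (R : realType) (d : measure_display) (T : measurableType d)
  (P : probability T R) (N : nat).

Definition standardized (X : 'I_N -> 'I_N -> {RV P >-> R}) : Prop :=
  forall i j : 'I_N,
    ('E_P[X i j] = 0 /\ 'E_P[(fun w => (X i j w ^+ 2)%R)] = 1)%E.

Definition couplings (J Y : 'I_N -> 'I_N -> {RV P >-> R}) : Prop :=
  [/\ mutually_independent (fun ij : 'I_N * 'I_N => J ij.1 ij.2),
      mutually_independent (fun ij : 'I_N * 'I_N => Y ij.1 ij.2),
      independent_families (fun ij : 'I_N * 'I_N => J ij.1 ij.2)
                           (fun ij : 'I_N * 'I_N => Y ij.1 ij.2),
      standardized J & standardized Y].

(* The base value 0 is harmless: the moments are nonnegative. *)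
Definition gamma (J Y : 'I_N -> 'I_N -> {RV P >-> R}) : \bar R :=
  \big[Order.max/0%E]_(ij : 'I_N * 'I_N)
    Order.max ('E_P[(fun w => (`|J ij.1 ij.2 w| ^+ 3)%R)])%E
              ('E_P[(fun w => (`|Y ij.1 ij.2 w| ^+ 3)%R)])%E.

(* (1/N^2) sum_(i,j) E[X_ij^2 ; |X_ij| > eps sqrt N] *)
Definition truncated_second_moment (X : 'I_N -> 'I_N -> {RV P >-> R})
    (eps : R) : \bar R :=
  ((((N%:R ^+ 2)^-1)%R)%:E *
   \sum_(i < N) \sum_(j < N)
     \int[P]_(w in [set w | (eps * Num.sqrt N%:R < `|X i j w|)%R])
       (X i j w ^+ 2)%R%:E)%E.

End couplings.

(* Lindeberg's condition for the triangular array (X N i j), whose N-th level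
   has N^2 entries of variance 1 weighted by 1 / sqrt N. It holds if all entries
   have the same law for all N, or if their squares are uniformly integrable.
   Without it universality can fail: X N i j = N or - N, each with probability
   1 / (2 N^2), and 0 otherwise, has mean 0 and variance 1, but expected maximal
   energy at most sqrt N, against an order N for random signs. *)
Definition lindeberg (R : realType) (d : nat -> measure_display)
    (T : forall N, measurableType (d N)) (P : forall N, probability (T N) R)
    (X : forall N, 'I_N -> 'I_N -> {RV (P N) >-> R}) : Prop :=
  forall eps : R, 0 < eps ->
    (fun N : nat => truncated_second_moment (X N) eps) @ \oo --> 0%E.

Section objective.
Variables (R : realType) (N : nat).

(* [eta : {ffun 'I_N -> bool}] encodes an element of {0,1}^N. *)
Definition H (X : 'I_N -> 'I_N -> R) (eta : {ffun 'I_N -> bool}) : R :=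
  (Num.sqrt N%:R)^-1 *
  \sum_(i < N) \sum_(j < N) X i j * (eta i)%:R * (eta j)%:R.

(* The base value of the iterated minimum (maximum) is itself a value of
   [H X], so these are the minimum and maximum over {0,1}^N. *)
Definition minH (X : 'I_N -> 'I_N -> R) : R :=
  \big[Num.min/H X [ffun=> false]]_(eta : {ffun 'I_N -> bool}) H X eta.

Definition maxH (X : 'I_N -> 'I_N -> R) : R :=
  \big[Num.max/H X [ffun=> false]]_(eta : {ffun 'I_N -> bool}) H X eta.

End objective.

(* The differences are taken in the extended reals, so that a bound on them
   includes the finiteness of both expectations. *)
Definition min_gap (R : realType) (d : measure_display) (T : measurableType d)
    (P : probability T R) (N : nat) (J Y : 'I_N -> 'I_N -> {RV P >-> R}) :
    \bar R :=
  ((N%:R^-1)%R%:E *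
   `| 'E_P[(fun w => minH (fun i j => J i j w))] -
      'E_P[(fun w => minH (fun i j => Y i j w))] |)%E.

Definition max_gap (R : realType) (d : measure_display) (T : measurableType d)
    (P : probability T R) (N : nat) (J Y : 'I_N -> 'I_N -> {RV P >-> R}) :
    \bar R :=
  ((N%:R^-1)%R%:E *
   `| 'E_P[(fun w => maxH (fun i j => J i j w))] -
      'E_P[(fun w => maxH (fun i j => Y i j w))] |)%E.

(* Main.v *)
(* Lindeberg's replacement method, applied to a soft maximum. For b > 0 the
   log-partition function of the Gibbs weights [expR (b * H X eta)] is within
   [ln (2 ^ N) <= N] of b times the maximum of [H X]; with b < 0 it
   approximates the minimum. As a function of a single entry t, the
   log-partition function is a constant plus the cumulant generating function
   [ln (1 - p + p * expR (c * t))] of a Bernoulli variable, where p is the Gibbs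
   probability that the entry contributes to the energy, computed with t = 0,
   and [c = b / sqrt N]. Its second order Taylor remainder is at most
   min (|c t|^2, |c t|^3). Since p is independent of the entry, replacing J_ij
   by Y_ij leaves the terms of order at most 2 unchanged in expectation, and
   only these remainders are left. The cubic bound and b = N^(1/6) give the
   rate N^(-1/6). Without third moments, splitting at |t| = eps * sqrt N gives
   an error 2/b + 2 b^2 eps + o(1), and one lets eps tend to 0 and then b to
   infinity. *)

From HB Require Import structures.
Require Import Defs.
From mathcomp Require Import measurable_realfun ring lra.

Set Implicit Arguments.
Unset Strict Implicit.
Unset Printing Implicit Defensive.

Local Open Scope classical_set_scope.
Local Open Scope ring_scope.

(** * Taylor remainder of the Bernoulli cumulant generating function *)

Section bernoulli_cgf.
Variable R : realType.
Implicit Types p t x : R.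

(** By the mean value theorem f x = f' y * x with |y| <= |x|. The factor 1 / (n + 1) that
    integration would gain is given up, so the bound iterates without constants. *)
Lemma le_norm_exp_of_derive (f f' : R -> R) (n : nat) :
  (forall x, is_derive x 1 f (f' x)) -> f 0 = 0 ->
  (forall x, `|f' x| <= `|x| ^+ n) -> forall x, `|f x| <= `|x| ^+ n.+1.
Proof.
move=> df f0 f'n x.
have cf a b : {within `[a, b], continuous f}.
  apply: continuous_subspaceT => y.
  by apply/differentiable_continuous/derivable1_diffP; have [] := df y.
have bound y : `|y| <= `|x| -> `|f' y * x| <= `|x| ^+ n.+1.
  move=> yx; rewrite normrM exprSr ler_wpM2r// (le_trans (f'n y))//.
  by rewrite lerXn2r.
have [x0|x0] := leP 0 x.
  have [y /[!in_itv]/= /andP[y0 yx]] :=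
    MVT_segment x0 (fun y _ => df y) (cf 0 x).
  by rewrite f0 !subr0 => ->; apply: bound; rewrite !ger0_norm.
have [y /[!in_itv]/= /andP[xy y0]] :=
  MVT_segment (ltW x0) (fun y _ => df y) (cf x 0).
rewrite f0 !sub0r => /(congr1 Num.norm); rewrite normrN mulrN normrN => ->.
by apply: bound; rewrite !ler0_norm ?lerN2// (ltW x0).
Qed.

Definition bernoulli_cgf p t : R := ln (1 - p + p * expR t).

(** The success probability q of the exponentially tilted Bernoulli law: it is the derivative of
    [bernoulli_cgf], and its own derivative is the tilted variance q (1 - q). *)
Definition bernoulli_tilt p t : R := p * expR t / (1 - p + p * expR t).

Section fixed_parameter.
Variable p : R.
Hypothesis p01 : 0 <= p <= 1.

Lemma bernoulli_mgf_gt0 t : 0 < 1 - p + p * expR t.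
Proof. by have := expR_gt0 t; move: p01 => /andP[]; nra. Qed.

Lemma bernoulli_tilt_01 t : 0 <= bernoulli_tilt p t <= 1.
Proof.
have p0 := bernoulli_mgf_gt0 t; have := expR_gt0 t => et.
rewrite /bernoulli_tilt ler_pdivrMr// mul1r divr_ge0 ?(ltW p0)//=; last first.
  by rewrite mulr_ge0 ?(ltW et)//; case/andP: p01.
by move: p01 => /andP[? ?]; lra.
Qed.

Lemma bernoulli_tilt0 : bernoulli_tilt p 0 = p.
Proof. by rewrite /bernoulli_tilt expR0 mulr1 subrK divr1. Qed.

Lemma bernoulli_cgf0 : bernoulli_cgf p 0 = 0.
Proof. by rewrite /bernoulli_cgf expR0 mulr1 subrK ln1. Qed.

Lemma is_derive_bernoulli_mgf t :
  is_derive t 1 (fun s => 1 - p + p * expR s) (p * expR t).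
Proof. by apply: is_derive_eq; rewrite add0r mul1r. Qed.

Lemma is_derive_bernoulli_cgf t :
  is_derive t 1 (bernoulli_cgf p) (bernoulli_tilt p t).
Proof.
have h := is_derive_bernoulli_mgf t.
have h2 := is_derive1_ln (bernoulli_mgf_gt0 t).
rewrite /bernoulli_tilt mulrC.
exact: (@is_derive1_comp _ (@ln R) (fun s => 1 - p + p * expR s) _ _ _ h2 h).
Qed.

Lemma is_derive_bernoulli_tilt t : is_derive t 1 (bernoulli_tilt p)
  (bernoulli_tilt p t * (1 - bernoulli_tilt p t)).
Proof.
have h := is_derive_bernoulli_mgf t.
have m0 := bernoulli_mgf_gt0 t.
have h2 := @is_deriveV R (fun s => 1 - p + p * expR s) _ _ _ (lt0r_neq0 m0) h.
have h3 : is_derive t 1 (fun s => p * expR s) (p * expR t).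
  exact: is_derive_eq.
apply: (is_derive_eq (is_deriveM h3 h2)).
rewrite /bernoulli_tilt /GRing.scale/=.
by field; rewrite lt0r_neq0.
Qed.

Definition bernoulli_cgf_rem t : R :=
  bernoulli_cgf p t - p * t - p * (1 - p) / 2 * t ^+ 2.

Let rem1 t : R := bernoulli_tilt p t - p - p * (1 - p) * t.

Let rem2 t : R :=
  bernoulli_tilt p t * (1 - bernoulli_tilt p t) - p * (1 - p).

Let is_derive_rem t : is_derive t 1 bernoulli_cgf_rem (rem1 t).
Proof.
have h := is_derive_bernoulli_cgf t.
rewrite /bernoulli_cgf_rem; apply: is_derive_eq.
by rewrite /rem1 /GRing.scale/=; field.
Qed.

Let is_derive_rem1 t : is_derive t 1 rem1 (rem2 t).
Proof.
have h := is_derive_bernoulli_tilt t.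
rewrite /rem1; apply: is_derive_eq.
by rewrite /rem2 /GRing.scale/=; field.
Qed.

Let is_derive_rem2 t : is_derive t 1 rem2
  (bernoulli_tilt p t * (1 - bernoulli_tilt p t)
     * (1 - 2 * bernoulli_tilt p t)).
Proof.
have h := is_derive_bernoulli_tilt t.
rewrite /rem2; apply: is_derive_eq.
by rewrite /GRing.scale/=; field.
Qed.

Let rem2_0 : rem2 0 = 0.
Proof. by rewrite /rem2 bernoulli_tilt0 subrr. Qed.

Let rem1_0 : rem1 0 = 0.
Proof. by rewrite /rem1 bernoulli_tilt0 subrr mulr0 subrr. Qed.

Let rem_0 : bernoulli_cgf_rem 0 = 0.
Proof. by rewrite /bernoulli_cgf_rem bernoulli_cgf0 expr0n/= !mulr0 !subr0. Qed.

(** The second derivative of the remainder is a difference of two Bernoulli variances, hence at most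
    1 in absolute value; two integrations from 0 give the square. *)
Lemma bernoulli_cgf_rem_le2 t : `|bernoulli_cgf_rem t| <= `|t| ^+ 2.
Proof.
apply: (le_norm_exp_of_derive is_derive_rem) => // {}t.
apply: (le_norm_exp_of_derive is_derive_rem1) => // {}t.
have /andP[q0 q1] := bernoulli_tilt_01 t; have /andP[p0 p1] := p01.
by rewrite /rem2 expr0 ler_norml; nra.
Qed.

(** One more derivative gives q (1 - q) (1 - 2 q), again bounded by 1, uniformly in [p]. *)
Lemma bernoulli_cgf_rem_le3 t : `|bernoulli_cgf_rem t| <= `|t| ^+ 3.
Proof.
apply: (le_norm_exp_of_derive is_derive_rem) => // {}t.
apply: (le_norm_exp_of_derive is_derive_rem1) => // {}t.
apply: (le_norm_exp_of_derive is_derive_rem2) => // {}t.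
have /andP[] := bernoulli_tilt_01 t; move: (bernoulli_tilt p t) => q q0 q1.
have q2 : `|1 - 2 * q| <= 1 by rewrite ler_norml; lra.
rewrite expr0 !normrM (ger0_norm q0) (@ger0_norm _ (1 - q)) ?subr_ge0//.
by rewrite mulr_ile1 ?mulr_ge0 ?mulr_ile1 ?subr_ge0// gerBl.
Qed.

End fixed_parameter.
End bernoulli_cgf.

(** * Independence *)

Section independence.
Context (R : realType) (d : measure_display) (T : measurableType d).
Variable P : probability T R.

Lemma bigcap_family_sigma_algebra (I : finType) (X : I -> {RV P >-> R})
    (S : {set I}) (B : I -> set R) : (forall i, measurable (B i)) ->
  family_sigma_algebra X (\bigcap_(i in [set` S]) X i @^-1` B i).
Proof.
move=> mB; rewrite /family_sigma_algebra.
set G := \bigcup_(i in _) _.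
apply: (@fin_bigcap_measurable _ (g_sigma_algebraType G)) => // i _.
apply: sub_sigma_algebra; exists i => //.
by exists (B i) => //; rewrite setTI.
Qed.

(** An intersection of events of the hybrid family splits into a [J]-event and a [Y]-event.
    Independence of the two families factors these, and each family then has its own product
    rule. *)
Lemma mutually_independent_mix (I : finType) (J Y : I -> {RV P >-> R})
    (s : pred I) :
  mutually_independent J -> mutually_independent Y ->
  independent_families J Y ->
  mutually_independent (fun i => if s i then J i else Y i).
Proof.
move=> iJ iY JY S B mB.
have -> : \bigcap_(i in [set` S]) (if s i then J i else Y i) @^-1` B i =
    (\bigcap_(i in [set` S :&: finset s]) J i @^-1` B i) `&`
    (\bigcap_(i in [set` S :&: ~: finset s]) Y i @^-1` B i).
  apply/seteqP; split=> [w h|w [hJ hY] i /= iS].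
    by split=> i /=; rewrite !inE => /andP[iS si]; have := h i iS;
      rewrite ?si ?(negbTE si).
  by case: ifPn => si; [apply: hJ | apply: hY]; rewrite /= !inE iS.
rewrite JY; [|exact: bigcap_family_sigma_algebra..].
rewrite iJ// iY// [RHS](bigID s)/=; congr (_ * _)%E.
  by apply: eq_big => i; rewrite ?inE// => /andP[_ ->].
by apply: eq_big => i; rewrite ?inE// => /andP[_ /negbTE ->].
Qed.

(* A pi-system that generates the sigma-algebra of the variables [Z i],
   [i != k]. *)
Definition other_rectangles (I : finType) (Z : I -> {RV P >-> R}) (k : I) :
    set (set T) :=
  [set A | exists2 B : I -> set R, (forall i, measurable (B i)) &
     A = \bigcap_(i in [set` [set~ k]%SET]) Z i @^-1` B i].

Section one_coordinate.
Variables (I : finType) (Z : I -> {RV P >-> R}) (k : I).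

Let G := other_rectangles Z k.

Lemma measurable_other_rectangles : G `<=` measurable.
Proof.
move=> _ [B mB ->]; apply: fin_bigcap_measurable => // i _.
exact: measurable_funPTI.
Qed.

Lemma measurable_fun_other (j : I) : j != k ->
  measurable_fun [set: g_sigma_algebraType G]
    (Z j : g_sigma_algebraType G -> R).
Proof.
move=> jk _ B mB; rewrite setTI; apply: sub_sigma_algebra.
exists (fun i => if i == j then B else setT); first by move=> i; case: ifP.
apply/seteqP; split=> [w Bw i _ /=|w /(_ j)]; first by case: eqP => [->|].
by rewrite /= !inE eqxx jk; apply.
Qed.

Lemma measurable_fun_of_other (U : T -> R) :
  measurable_fun [set: g_sigma_algebraType G]
    (U : g_sigma_algebraType G -> R) ->
  measurable_fun [set: T] U.
Proof.
move=> mU _ B mB.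
have sGm := smallest_sub (@sigma_algebra_measurable _ T)
  measurable_other_rectangles.
exact: sGm (mU measurableT B mB).
Qed.

(** With K the event on [Z k], the finite measures A -> P (A & K) and A -> P K * P A agree on the
    pi-system of rectangles, hence on the sigma-algebra it generates. *)
Lemma independent_other (A : set T) (C : set R) : mutually_independent Z ->
  <<s G >> A -> measurable C ->
  P (A `&` Z k @^-1` C) = (P A * P (Z k @^-1` C))%E.
Proof.
move=> iZ GA mC; set K := Z k @^-1` C.
have mK : measurable K by exact: measurable_funPTI.
have PK0 : 0 <= fine (P K) by exact: fine_ge0.
pose m1 : {measure set T -> \bar R} := mrestr P mK.
pose m2 : {measure set T -> \bar R} := mscale (NngNum PK0) P.
suff : m1 A = m2 A.
  by rewrite /m1 /m2 /= /mrestr /mscale/= fineK ?fin_num_measure// muleC.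
apply: (g_sigma_algebra_measure_unique G measurable_other_rectangles
  (fun=> setT)) => //.
- move=> _; exists (fun=> setT) => //; apply/seteqP; split=> //.
- by rewrite bigcup_const//; exists 0%N.
- move=> _ _ [B1 mB1 ->] [B2 mB2 ->]; exists (fun i => B1 i `&` B2 i).
    by move=> i; exact: measurableI.
  by rewrite -bigcapI.
- move=> _ [B mB ->]; rewrite /m1 /m2 /= /mrestr /mscale/=.
  rewrite fineK ?fin_num_measure//.
  (* Inserting [C] at [k] turns the intersection with [K] into a rectangle over all of [I], to which
     the product rule applies. *)
  pose B' i := if i == k then C else B i.
  have mB' i : measurable (B' i) by rewrite /B'; case: ifP.
  have -> : (\bigcap_(i in [set` [set~ k]%SET]) Z i @^-1` B i) `&` K =
      \bigcap_(i in [set` [set: I]%SET]) Z i @^-1` B' i.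
    apply/seteqP; split=> [w [h hk] i _|w h].
      rewrite /B'; case: eqP => [->//|/eqP ik]; apply: h.
      by rewrite /= !inE.
    split=> [i|].
      rewrite /= !inE => ik.
      by have := h i; rewrite /B' (negbTE ik)/= inE; apply.
    by have := h k; rewrite /B' eqxx/= inE; apply.
  rewrite iZ// iZ// (bigD1 k) ?inE//=; congr (_ * _)%E.
    by rewrite /B' eqxx.
  apply: eq_big => i; rewrite !inE// => ik.
  by rewrite /B' (negbTE ik).
- by move=> _; rewrite /m1/= /mrestr setTI -ge0_fin_numE// fin_num_measure.
Qed.

End one_coordinate.

(** The joint law of (U, V) is the product of the marginal laws, by uniqueness of the product
    measure; Fubini then factors the integral of the product. *)
Lemma Rintegral_mul_independent (U V : T -> R) :
  measurable_fun [set: T] U -> measurable_fun [set: T] V ->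
  (forall A B, measurable A -> measurable B ->
     P (U @^-1` A `&` V @^-1` B) = (P (U @^-1` A) * P (V @^-1` B))%E) ->
  P.-integrable setT (EFin \o U) -> P.-integrable setT (EFin \o V) ->
  P.-integrable setT (EFin \o (U \* V)) ->
  (\int[P]_w (U w * V w) = (\int[P]_w U w) * (\int[P]_w V w))%R.
Proof.
move=> mU mV UV iU iV iUV.
pose U' : {RV P >-> R} := HB.pack U (isMeasurableFun.Build _ _ _ _ U mU).
pose V' : {RV P >-> R} := HB.pack V (isMeasurableFun.Build _ _ _ _ V mV).
have mUV : measurable_fun [set: T] (fun w => (U w, V w)).
  exact: measurable_fun_pair.
pose W' : {RV P >-> (R * R)%type} :=
  HB.pack (fun w => (U w, V w)) (isMeasurableFun.Build _ _ _ _ _ mUV).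
pose mu := distribution P U'; pose nu := distribution P V'.
have jointE : forall X, measurable X -> (mu \x nu)%E X = distribution P W' X.
  by apply: product_measure_unique => A B mA mB; exact: UV.
pose f (z : R * R) : \bar R := (z.1 * z.2)%:E.
have mf : measurable_fun [set: R * R] f.
  by apply/measurable_EFinP; exact: measurable_funM.
have iW : P.-integrable setT (f \o W') by [].
have iprod : (mu \x nu)%E.-integrable setT f.
  have /integrableP[_ ioo] := integrable_pushforward (measurable_funPT W')
    mf iW measurableT.
  apply/integrableP; split=> //; apply: le_lt_trans ioo.
  rewrite le_eqVlt; apply/orP; left; apply/eqP.
  by apply: eq_measure_integral => X mX _; exact: jointE.
have E1 : (\int[P]_w (U w * V w)%:E = \int[mu \x nu]_z f z)%E.
  transitivity (\int[distribution P W']_z f z)%E.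
    by rewrite integral_distribution.
  by apply: eq_measure_integral => X mX _; exact/esym/jointE.
have iV' : nu.-integrable setT (EFin : R -> \bar R).
  exact: (integrable_pushforward (measurable_funPT V')).
have iU' : mu.-integrable setT (EFin : R -> \bar R).
  exact: (integrable_pushforward (measurable_funPT U')).
rewrite /Rintegral E1 -(integral12_prod_meas1 iprod) /fubini_F/=.
under eq_integral.
  move=> x _; rewrite -[X in integral _ _ X]/(fun y => x%:E * y%:E)%E.
  rewrite integralZl//.
  over.
rewrite /= -(fineK (integrable_fin_num measurableT iV')).
rewrite integralZr//= fineM ?integrable_fin_num//.
have EU : (\int[mu]_x x%:E = \int[P]_w (U w)%:E)%E.
  by rewrite (@integral_distribution _ _ _ _ _ _ U' EFin).
have EV : (\int[nu]_x x%:E = \int[P]_w (V w)%:E)%E.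
  by rewrite (@integral_distribution _ _ _ _ _ _ V' EFin).
by rewrite EU EV.
Qed.

End independence.

(** * Log-partition functions *)

Section log_partition.
Context (R : realType) (E I : finType) (a : E -> I -> bool) (c : R).
Implicit Types (x : I -> R) (k : I) (e : E).

(** Coefficients restricted to 0 and 1 make each coordinate either present or absent in a
    configuration, which is what produces a Bernoulli law below. *)
Definition energy x e : R := \sum_i (a e i)%:R * x i.

Definition partition_fun x : R := \sum_e expR (c * energy x e).

Definition log_partition x : R := ln (partition_fun x).

Definition erase k x : I -> R := fun i => if i == k then 0 else x i.

Definition gibbs_prob k x : R :=
  (\sum_(e | a e k) expR (c * energy (erase k x) e))
    / partition_fun (erase k x).

Lemma energy_erase k x e :
  energy x e = energy (erase k x) e + (a e k)%:R * x k.
Proof.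
rewrite /energy (bigD1 k)//= [in RHS](bigD1 k)//= /erase eqxx mulr0 add0r addrC.
by congr (_ + _); apply: eq_bigr => i /negbTE ->.
Qed.

Lemma ler_norm_energy x e : `|energy x e| <= \sum_i `|x i|.
Proof.
rewrite (le_trans (ler_norm_sum _ _ _))// ler_sum// => i _.
by case: (a e i); rewrite ?mul1r// mul0r normr0.
Qed.

Hypothesis E0 : (0 < #|E|)%N.

Lemma partition_fun_gt0 x : 0 < partition_fun x.
Proof.
case/card_gt0P: E0 => e _.
rewrite /partition_fun (bigD1 e)//= ltr_pwDl ?expR_gt0//.
by apply: sumr_ge0 => *; exact: expR_ge0.
Qed.

Lemma gibbs_prob_01 k x : 0 <= gibbs_prob k x <= 1.
Proof.
have Z0 := partition_fun_gt0 (erase k x).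
rewrite /gibbs_prob ler_pdivrMr// mul1r divr_ge0 ?(ltW Z0)//=; last first.
  by apply: sumr_ge0 => *; exact: expR_ge0.
rewrite [leRHS](bigID (a^~ k))/= lerDl.
by apply: sumr_ge0 => *; exact: expR_ge0.
Qed.

(** Restoring entry [k] multiplies by [expR (c * x k)] exactly the weights of the configurations
    that use it; their share of the erased partition function is [gibbs_prob k x]. *)
Lemma log_partition_erase k x : log_partition x =
  log_partition (erase k x) + bernoulli_cgf (gibbs_prob k x) (c * x k).
Proof.
have Z0 := partition_fun_gt0 (erase k x).
rewrite /log_partition /bernoulli_cgf -lnM; last 2 first.
- by rewrite posrE.
- by rewrite posrE bernoulli_mgf_gt0// gibbs_prob_01.
congr ln; rewrite mulrDr mulrBr mulr1.
have pE : partition_fun (erase k x) * gibbs_prob k x =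
    \sum_(e | a e k) expR (c * energy (erase k x) e).
  by rewrite /gibbs_prob mulrC divfK// gt_eqF.
rewrite mulrA pE {1}[partition_fun (erase k x)](bigID (a^~ k))/=.
rewrite [_ + _ - _]addrAC subrr add0r mulr_suml addrC.
rewrite [LHS](bigID (a^~ k))/=; congr (_ + _); apply: eq_bigr => e.
  by move=> aek; rewrite (energy_erase k) aek mul1r mulrDr expRD.
by move=> /negbTE aek; rewrite (energy_erase k) aek mul0r addr0.
Qed.

Lemma log_partition_ge x e : c * energy x e <= log_partition x.
Proof.
rewrite -ler_expR lnK ?posrE ?partition_fun_gt0//.
rewrite /partition_fun (bigD1 e)//= lerDl.
by apply: sumr_ge0 => *; exact: expR_ge0.
Qed.

Lemma log_partition_le x M : (forall e, c * energy x e <= M) ->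
  log_partition x <= M + ln #|E|%:R.
Proof.
move=> cM; rewrite -ler_expR lnK ?posrE ?partition_fun_gt0// expRD.
rewrite lnK; last first.
  by rewrite posrE ltr0n.
rewrite mulr_natr -sumr_const; apply: ler_sum => e _.
by rewrite ler_expR.
Qed.

(** Linear growth in the entries: the log-partition function is integrable as soon as the entries
    are. *)
Lemma ler_norm_log_partition x :
  `|log_partition x| <= `|c| * \sum_i `|x i| + ln #|E|%:R.
Proof.
have cE e : `|c * energy x e| <= `|c| * \sum_i `|x i|.
  by rewrite normrM ler_wpM2l// ler_norm_energy.
case/card_gt0P: (E0) => e _.
rewrite ler_norml; apply/andP; split.
  apply: le_trans (log_partition_ge x e).
  apply: (@le_trans _ _ (- (`|c| * \sum_i `|x i|))).
    by rewrite lerN2 lerDl ln_ge0// ler1n.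
  by have := cE e; rewrite ler_norml => /andP[].
by apply: log_partition_le => e'; rewrite (le_trans (ler_norm _)).
Qed.

End log_partition.

Section log_partition_measurable.
Context (R : realType) (E I : finType) (a : E -> I -> bool) (c : R).
Context (d : measure_display) (T : measurableType d).

Lemma measurable_erase (k : I) (X : I -> T -> R) :
  (forall i, i != k -> measurable_fun [set: T] (X i)) ->
  forall i, measurable_fun [set: T] (fun w => erase k (X^~ w) i).
Proof.
move=> mX i; rewrite /erase; case: eqP => [_|/eqP/mX//].
exact: measurable_cst.
Qed.

Variable X : I -> T -> R.

Lemma measurable_expR_energy (e : E) :
  (forall i, measurable_fun [set: T] (X i)) ->
  measurable_fun [set: T] (fun w => expR (c * energy a (X^~ w) e)).
Proof.
move=> mX; apply: measurableT_comp => //; apply: measurable_funM => //.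
by apply: measurable_sum => i; exact: measurable_funM.
Qed.

Lemma measurable_partition_fun :
  (forall i, measurable_fun [set: T] (X i)) ->
  measurable_fun [set: T] (fun w => partition_fun a c (X^~ w)).
Proof.
by move=> mX; apply: measurable_sum => e; exact: measurable_expR_energy.
Qed.

Lemma measurable_log_partition :
  (forall i, measurable_fun [set: T] (X i)) ->
  measurable_fun [set: T] (fun w => log_partition a c (X^~ w)).
Proof.
move=> mX; apply: measurableT_comp; first exact: measurable_ln.
exact: measurable_partition_fun.
Qed.

End log_partition_measurable.

(** Nothing is asked of entry [k], so that the lemma applies to the sigma-algebra generated by the
    other entries alone. *)
Lemma measurable_gibbs_prob (R : realType) (E I : finType) (a : E -> I -> bool)
    (c : R) (d : measure_display) (T : measurableType d) (k : I)
    (X : I -> T -> R) : (0 < #|E|)%N ->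
  (forall i, i != k -> measurable_fun [set: T] (X i)) ->
  measurable_fun [set: T] (fun w => gibbs_prob a c k (X^~ w)).
Proof.
move=> E0 /measurable_erase mX; apply: measurable_funM.
  under eq_fun do rewrite big_mkcond/=.
  apply: measurable_sum => e; case: (a e k) => //.
  exact: measurable_expR_energy.
(* Writing the inverse as an exponential reduces its measurability to that of the log-partition
   function. *)
have pE w : (partition_fun a c (erase k (X^~ w)))^-1 =
    expR (- log_partition a c (erase k (X^~ w))).
  by rewrite expRN lnK// posrE partition_fun_gt0.
under eq_fun do rewrite pE.
apply: measurableT_comp => //; apply: measurableT_comp => //.
exact: measurable_log_partition.
Qed.

(** * Replacement *)

Section integrability.
Context (R : realType) (d : measure_display) (T : measurableType d).
Variable P : probability T R.
Implicit Types f g : T -> R.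

Lemma integrable_le_norm f g : measurable_fun [set: T] f ->
  P.-integrable setT (EFin \o g) -> (forall w, `|f w| <= g w) ->
  P.-integrable setT (EFin \o f).
Proof.
move=> mf ig fg; apply: le_integrable ig => //; first exact/measurable_EFinP.
by move=> w _ /=; rewrite lee_fin (le_trans (fg w))// ler_norm.
Qed.

Lemma integrable_mulr_bounded f g M : measurable_fun [set: T] f ->
  (forall w, `|f w| <= M) -> P.-integrable setT (EFin \o g) ->
  P.-integrable setT (EFin \o (f \* g)).
Proof.
move=> mf fM ig; have mg := measurable_int _ ig.
apply: (@integrable_le_norm _ (fun w => M * `|g w|)).
- by apply: measurable_funM => //; exact/measurable_EFinP.
- have := integrableZl measurableT M (integrable_norm ig).
  by apply: eq_integrable => // w _; rewrite /= EFinM.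
- by move=> w; rewrite normrM ler_wpM2r.
Qed.

Lemma expectation_Rintegral f : P.-integrable setT (EFin \o f) ->
  ('E_P[f] = (\int[P]_w f w)%R%:E)%E.
Proof. by move=> fi; rewrite unlock fineK// integrable_fin_num. Qed.

Section standardized_variable.
Variable X : {RV P >-> R}.
Hypotheses (X1 : ('E_P[X] = 0)%E) (X2 : ('E_P[fun w => (X w ^+ 2)%R] = 1)%E).

Lemma integrable_sqr : P.-integrable setT (EFin \o (fun w => X w ^+ 2)).
Proof.
apply/integrableP; split.
  by apply/measurable_EFinP; exact: measurable_funX.
under eq_integral do rewrite /= ger0_norm ?sqr_ge0//.
by move: X2; rewrite unlock => ->; rewrite ltry.
Qed.

(** Integrability is drawn from the second moment, through |x| <= 1 + x^2. *)
Lemma integrable_standardized : P.-integrable setT (EFin \o X).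
Proof.
apply: (@integrable_le_norm _ (fun w => 1 + X w ^+ 2)) => //.
  have := integrableD measurableT
    (finite_measure_integrable_cst P 1 measurableT)
    integrable_sqr.
  by apply: eq_integrable => // w _; rewrite /= EFinD.
by move=> w; rewrite ler_norml; nra.
Qed.

Lemma Rintegral_standardized : \int[P]_w X w = 0.
Proof.
apply: EFin_inj; rewrite -expectation_Rintegral//.
exact: integrable_standardized.
Qed.

Lemma Rintegral_sqr : \int[P]_w X w ^+ 2 = 1.
Proof.
apply: EFin_inj; rewrite -expectation_Rintegral//; exact: integrable_sqr.
Qed.

End standardized_variable.
End integrability.

(** Both remainder bounds are kept: the square is integrable under unit variance alone, and the cube
    is the smaller one for small arguments. *)
Definition min23 (R : realType) (t : R) : R :=
  Num.min (`|t| ^+ 2) (`|t| ^+ 3).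

Section replacement.
Context (R : realType) (d : measure_display) (T : measurableType d).
Context (P : probability T R) (E I : finType) (a : E -> I -> bool) (c : R).
Hypothesis E0 : (0 < #|E|)%N.

Let F (X : I -> {RV P >-> R}) (w : T) : R := log_partition a c (X^~ w).

Definition standardized_family (X : I -> {RV P >-> R}) : Prop :=
  forall i, ('E_P[X i] = 0 /\ 'E_P[fun w => (X i w ^+ 2)%R] = 1)%E.

Lemma integrable_min23 (X : {RV P >-> R}) :
  ('E_P[fun w => (X w ^+ 2)%R] = 1)%E ->
  P.-integrable setT (EFin \o (fun w => min23 (c * X w))).
Proof.
move=> X2; apply: (@integrable_le_norm _ _ _ _ _
  (fun w => c ^+ 2 * X w ^+ 2)).
- apply: measurable_minr; apply: measurable_funX; apply: measurableT_comp => //;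
    exact: measurable_funM.
- have := integrableZl measurableT (c ^+ 2) (integrable_sqr X2).
  by apply: eq_integrable => // w _; rewrite /= EFinM.
- move=> w; rewrite ger0_norm; last by rewrite /min23 le_min !exprn_ge0.
  by rewrite /min23 ge_min -exprMn real_normK ?num_real// lexx.
Qed.

Section one_family.
Variable X : I -> {RV P >-> R}.
Hypothesis stdX : standardized_family X.

Let iX i : P.-integrable setT (EFin \o X i).
Proof. by have [_ X2] := stdX i; exact: integrable_standardized. Qed.

Let i_bound : P.-integrable setT (EFin \o
  (fun w => `|c| * (\sum_i `|X i w|) + ln #|E|%:R)).
Proof.
have iS : P.-integrable setT (fun w => \sum_i (`|X i w|)%:E)%E.
  apply: (integrable_sum measurableT) => i _.
  exact: (integrable_norm (iX i)).
have := integrableD measurableT (integrableZl measurableT `|c| iS)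
  (finite_measure_integrable_cst P (ln #|E|%:R) measurableT).
by apply: eq_integrable => // w _; rewrite /= EFinD EFinM sumEFin.
Qed.

Lemma integrable_log_partition : P.-integrable setT (EFin \o F X).
Proof.
apply: integrable_le_norm i_bound _; first exact: measurable_log_partition.
by move=> w; exact: ler_norm_log_partition.
Qed.

Lemma integrable_log_partition_erase k : P.-integrable setT
  (EFin \o (fun w => log_partition a c (erase k (X^~ w)))).
Proof.
apply: integrable_le_norm i_bound _.
  apply: measurable_log_partition => i.
  exact: (@measurable_erase _ _ _ _ k (fun i w => X i w)).
move=> w; rewrite (le_trans (ler_norm_log_partition a c E0 _))// lerD2r.
rewrite ler_wpM2l// ler_sum// => i _; rewrite /erase; case: eqP => // _.
by rewrite normr0.
Qed.

Hypothesis indX : mutually_independent X.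
Variable k : I.

Let p (w : T) : R := gibbs_prob a c k (X^~ w).

(* The quantity subtracted does not depend on the law of [X k]. *)
Lemma log_partition_erase_expectation :
  `|\int[P]_w F X w - \int[P]_w log_partition a c (erase k (X^~ w))
    - c ^+ 2 / 2 * \int[P]_w (p w * (1 - p w))| <=
  \int[P]_w min23 (c * X k w).
Proof.
have [X1 X2] := stdX k.
pose G := other_rectangles X k.
(* As [p] is computed with entry [k] erased, it is measurable for the other entries, hence
   independent of [X k]; the same holds for p (1 - p). *)
have mpG : measurable_fun [set: g_sigma_algebraType G]
    (p : g_sigma_algebraType G -> R).
  apply: (@measurable_gibbs_prob _ _ _ a c _ (g_sigma_algebraType G) k
    (fun i w => X i w) E0) => i ik.
  exact: measurable_fun_other.
have mqG : measurable_fun [set: g_sigma_algebraType G]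
    ((fun w => p w * (1 - p w)) : g_sigma_algebraType G -> R).
  by apply: measurable_funM => //; exact: measurable_funB.
have mp := measurable_fun_of_other mpG.
have mq := measurable_fun_of_other mqG.
have p01 w : 0 <= p w <= 1 by exact: gibbs_prob_01.
have p1 w : `|p w| <= 1 by have /andP[? ?] := p01 w; rewrite ger0_norm.
have q1 w : `|p w * (1 - p w)| <= 1.
  by have /andP[? ?] := p01 w; rewrite ger0_norm; nra.
have i1 : P.-integrable setT (EFin \o (cst 1 : T -> R)).
  exact: finite_measure_integrable_cst.
have ip : P.-integrable setT (EFin \o p) by exact: integrable_le_norm i1 _.
have iq : P.-integrable setT (EFin \o (fun w => p w * (1 - p w))).
  exact: integrable_le_norm i1 _.
have ipX := integrable_mulr_bounded mp p1 (iX k).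
have iqX := integrable_mulr_bounded mq q1 (integrable_sqr X2).
(* The linear Taylor term vanishes since [X k] is centred; in the quadratic one below, the unit
   second moment leaves only the mean of p (1 - p). *)
have EpX : \int[P]_w (p w * X k w) = 0.
  rewrite Rintegral_mul_independent// ?Rintegral_standardized ?mulr0//.
  move=> A B mA mB; apply: independent_other => //.
  by have := mpG measurableT A mA; rewrite setTI.
have EqX : \int[P]_w (p w * (1 - p w) * X k w ^+ 2) =
    \int[P]_w (p w * (1 - p w)).
  rewrite (Rintegral_mul_independent (V := fun w => X k w ^+ 2))//;
    last exact: integrable_sqr.
  - by rewrite Rintegral_sqr// mulr1.
  - exact: measurable_funX.
  - move=> A B mA mB.
    apply: (independent_other (C := (fun t => t ^+ 2) @^-1` B)) => //.
      by have := mqG measurableT A mA; rewrite setTI.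
    by rewrite -[X in measurable X]setTI; exact: measurable_funX.
pose D w := bernoulli_cgf_rem (p w) (c * X k w).
have DE w : D w = F X w - log_partition a c (erase k (X^~ w))
    - c * (p w * X k w) - c ^+ 2 / 2 * (p w * (1 - p w) * X k w ^+ 2).
  rewrite /D /bernoulli_cgf_rem /F (log_partition_erase a c E0 k) -/(p w).
  by field.
have iF := integrable_log_partition.
have iF0 := integrable_log_partition_erase k.
have iZ f r : P.-integrable setT (EFin \o f) ->
    P.-integrable setT (EFin \o (fun w => r * f w)).
  move=> fi; have := integrableZl measurableT r fi.
  by apply: eq_integrable => // w _; rewrite /= EFinM.
have iB f g : P.-integrable setT (EFin \o f) ->
    P.-integrable setT (EFin \o g) ->
    P.-integrable setT (EFin \o (fun w => f w - g w)).
  move=> fi gi; have := integrableB measurableT fi gi.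
  by apply: eq_integrable => // w _; rewrite /= EFinB.
have i2 := iB _ _ (iB _ _ iF iF0) (iZ _ c ipX).
have i3 := iB _ _ i2 (iZ _ (c ^+ 2 / 2) iqX).
have iD : P.-integrable setT (EFin \o D).
  rewrite (_ : D = fun w => F X w - log_partition a c (erase k (X^~ w))
    - c * (p w * X k w) - c ^+ 2 / 2 * (p w * (1 - p w) * X k w ^+ 2)).
    exact: i3.
  by apply/funext => w; exact: DE.
have -> : \int[P]_w F X w - \int[P]_w log_partition a c (erase k (X^~ w))
    - c ^+ 2 / 2 * \int[P]_w (p w * (1 - p w)) = \int[P]_w D w.
  under [RHS]eq_Rintegral do rewrite DE.
  rewrite RintegralB//; last exact: iZ _ _ iqX.
  rewrite RintegralB//; [|exact: iB _ _ iF iF0|exact: iZ _ _ ipX].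
  by rewrite RintegralB// !RintegralZl// EpX EqX mulr0 subr0.
apply: le_trans (le_normr_Rintegral measurableT iD) _.
apply: le_Rintegral => //; first exact: integrable_norm.
  exact: integrable_min23.
move=> w _; rewrite /min23 le_min.
by rewrite bernoulli_cgf_rem_le2// bernoulli_cgf_rem_le3.
Qed.

End one_family.

Variables J Y : I -> {RV P >-> R}.
Hypotheses (stdJ : standardized_family J) (stdY : standardized_family Y).
Hypotheses (indJ : mutually_independent J) (indY : mutually_independent Y).
Hypothesis indJY : independent_families J Y.

(** Telescoping over hybrid families in which the entries indexed by [s] come from [J] and the
    others from [Y]: each swap costs the two remainders of the swapped entry. *)
Lemma log_partition_replacement :
  `|\int[P]_w F J w - \int[P]_w F Y w| <=
  \sum_i (\int[P]_w min23 (c * J i w) + \int[P]_w min23 (c * Y i w)).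
Proof.
pose mix (s : seq I) i := if i \in s then J i else Y i.
have stdM s : standardized_family (mix s).
  by move=> i; rewrite /mix; case: ifP => _; [exact: stdJ | exact: stdY].
have indM s : mutually_independent (mix s).
  exact: (mutually_independent_mix (mem s) indJ indY).
suff H s : uniq s -> `|\int[P]_w F (mix s) w - \int[P]_w F Y w| <=
    \sum_(i <- s) (\int[P]_w min23 (c * J i w) + \int[P]_w min23 (c * Y i w)).
  have -> : J = mix (index_enum I).
    by apply/funext => i; rewrite /mix mem_index_enum.
  have := H _ (index_enum_uniq I).
  rewrite (_ : mix (index_enum I) = J)//.
  by apply/funext => i; rewrite /mix mem_index_enum.
(* Triangle inequality through the common centre L + V of two successive hybrids. *)
have aux (A B C L V S x y : R) : `|A - C| <= S -> `|A - L - V| <= y ->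
    `|B - L - V| <= x -> `|B - C| <= x + y + S.
  rewrite !ler_norml => /andP[? ?] /andP[? ?] /andP[? ?].
  by apply/andP; split; lra.
elim: s => [_|k s IHs /= /andP[ks us]].
  by rewrite big_nil (_ : mix [::] = Y) ?subrr ?normr0//; exact/funext.
rewrite big_cons.
(* The two hybrids differ only at [k], so the erased log-partition function and the Gibbs
   probability are the same for both. *)
have eqE w : erase k ((mix (k :: s))^~ w) = erase k ((mix s)^~ w).
  by apply/funext => i; rewrite /erase /mix inE; case: eqP.
have eqL : \int[P]_w log_partition a c (erase k ((mix (k :: s))^~ w)) =
    \int[P]_w log_partition a c (erase k ((mix s)^~ w)).
  by apply: eq_Rintegral => w _; rewrite eqE.
pose q (X : I -> {RV P >-> R}) w := gibbs_prob a c k (X^~ w).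
have eqq : \int[P]_w (q (mix (k :: s)) w * (1 - q (mix (k :: s)) w)) =
    \int[P]_w (q (mix s) w * (1 - q (mix s) w)).
  by apply: eq_Rintegral => w _; rewrite /q /gibbs_prob eqE.
have := log_partition_erase_expectation (stdM (k :: s)) (indM (k :: s)) k.
rewrite eqL eqq.
have := log_partition_erase_expectation (stdM s) (indM s) k.
have -> : mix (k :: s) k = J k by rewrite /mix mem_head.
have -> : mix s k = Y k by rewrite /mix (negbTE ks).
by move=> h1 h2; exact: aux (IHs us) h1 h2.
Qed.

End replacement.

(** * Maximal and minimal energy *)

Section extremal_energy.
Context (R : realType) (N : nat).
Implicit Types (x : 'I_N -> 'I_N -> R) (eta : {ffun 'I_N -> bool}).

(** The product of [eta i] and [eta j] is again 0 or 1, so the quadratic energy is linear in the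
    family of entries indexed by pairs. *)
Definition both_selected eta (ij : 'I_N * 'I_N) : bool := eta ij.1 && eta ij.2.

Lemma energy_both_selected x eta : (Num.sqrt N%:R)^-1 *
  energy both_selected (fun ij => x ij.1 ij.2) eta = H x eta.
Proof.
rewrite /H /energy pair_big/=; congr (_ * _); apply: eq_bigr => -[i j] _ /=.
rewrite /both_selected/=; case: (eta i); case: (eta j);
  by rewrite /= ?mul1r ?mul0r ?mulr1 ?mulr0.
Qed.

Lemma H_le_maxH x eta : H x eta <= maxH x.
Proof. exact: le_bigmax. Qed.

Lemma minH_le_H x eta : minH x <= H x eta.
Proof. exact: bigmin_le. Qed.

Lemma maxH_le x M : (forall eta, H x eta <= M) -> maxH x <= M.
Proof. by move=> HM; apply: bigmax_le => // *. Qed.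

Lemma le_minH x M : (forall eta, M <= H x eta) -> M <= minH x.
Proof. by move=> HM; apply: le_bigmin => // *. Qed.

(* The sign [s] is [1] when [opt] is the maximum and [-1] when it is the
   minimum. *)
Definition softly_approximated (s : R)
    (opt : ('I_N -> 'I_N -> R) -> R) : Prop :=
  forall b x, 0 < b ->
    `|log_partition both_selected (s * b / Num.sqrt N%:R)
        (fun ij => x ij.1 ij.2) - s * b * opt x| <= N%:R.

Let card_gt0 : (0 < #|{ffun 'I_N -> bool}|)%N.
Proof. by apply/card_gt0P; exists [ffun=> false]. Qed.

Let ln_card : ln (#|{ffun 'I_N -> bool}|%:R : R) <= N%:R.
Proof.
rewrite card_ffun card_bool card_ord natrX lnXn// -[_ *+ N]mulr_natl.
(* Here ln 2 <= 1 is ln (1 + x) <= x at x = 1. *)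
by rewrite ler_piMr// (@le_ln1Dx R 1).
Qed.

Let coefE s b x eta : s * b / Num.sqrt N%:R *
  energy both_selected (fun ij => x ij.1 ij.2) eta = s * b * H x eta.
Proof. by rewrite -mulrA energy_both_selected. Qed.

(** The partition sum is at least its largest term and at most 2^N times that term, so the
    difference lies between 0 and N. *)
Lemma softly_approximated_maxH : softly_approximated 1 (@maxH R N).
Proof.
move=> b x b0; rewrite ger0_norm ?lerBlDr ?subr_ge0.
  rewrite addrC.
  apply: (le_trans (log_partition_le (M := 1 * b * maxH x) card_gt0 _)).
    by move=> eta; rewrite coefE mul1r ler_pM2l//; exact: H_le_maxH.
  by rewrite lerD2l.
rewrite -mulrA mul1r -ler_pdivlMl//; apply: maxH_le => eta.
rewrite ler_pdivlMl// -[_ * _]mul1r mulrA -coefE.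
exact: log_partition_ge.
Qed.

(** With the negative factor -b the largest exponent is attained at the minimal energy; the
    difference again lies between 0 and N. *)
Lemma softly_approximated_minH : softly_approximated (- 1) (@minH R N).
Proof.
move=> b x b0; rewrite ger0_norm ?lerBlDr ?subr_ge0.
  rewrite addrC.
  apply: (le_trans (log_partition_le (M := - 1 * b * minH x) card_gt0 _)).
    move=> eta; rewrite coefE; rewrite ler_nM2l; first exact: minH_le_H.
    by rewrite mulN1r oppr_lt0.
  by rewrite lerD2l.
rewrite -mulrA mulN1r lerNl -ler_pdivrMl//; apply: le_minH => eta.
rewrite ler_pdivrMl// lerNl -[- (_ * _)]mulN1r mulrA -coefE.
exact: log_partition_ge.
Qed.

Context (d : measure_display) (T : measurableType d).
Variable X : 'I_N -> 'I_N -> T -> R.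
Hypothesis mX : forall i j, measurable_fun [set: T] (X i j).

Lemma measurable_H eta :
  measurable_fun [set: T] (fun w => H (fun i j => X i j w) eta).
Proof.
apply: measurable_funM => //; apply: measurable_sum => i.
apply: measurable_sum => j.
by apply: measurable_funM => //; exact: measurable_funM.
Qed.

Lemma measurable_maxH :
  measurable_fun [set: T] (fun w => maxH (fun i j => X i j w)).
Proof.
rewrite /maxH; elim: (index_enum _) => [|eta s IHs].
  by under eq_fun do rewrite big_nil; exact: measurable_H.
under eq_fun do rewrite big_cons.
by apply: measurable_maxr => //; exact: measurable_H.
Qed.

Lemma measurable_minH :
  measurable_fun [set: T] (fun w => minH (fun i j => X i j w)).
Proof.
rewrite /minH; elim: (index_enum _) => [|eta s IHs].
  by under eq_fun do rewrite big_nil; exact: measurable_H.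
under eq_fun do rewrite big_cons.
by apply: measurable_minr => //; exact: measurable_H.
Qed.

End extremal_energy.

(** * From log-partition functions to expected optima *)

Section gap.
Context (R : realType) (d : measure_display) (T : measurableType d).
Context (P : probability T R) (N : nat) (J Y : 'I_N -> 'I_N -> {RV P >-> R}).
Hypotheses (N0 : (0 < N)%N) (JY : couplings J Y).
Variables (s : R) (opt : ('I_N -> 'I_N -> R) -> R).
Hypotheses (s1 : `|s| = 1) (sopt : softly_approximated s opt).
Hypothesis mopt : forall X : 'I_N -> 'I_N -> {RV P >-> R},
  measurable_fun [set: T] (fun w => opt (fun i j => X i j w)).

(** With [opt] equal to [minH] or [maxH] this unfolds to [min_gap] or [max_gap], so both cases are
    treated at once. *)
Definition mean_gap : \bar R :=
  ((N%:R^-1)%R%:E *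
   `| 'E_P[(fun w => opt (fun i j => J i j w))] -
      'E_P[(fun w => opt (fun i j => Y i j w))] |)%E.

Let E := {ffun 'I_N -> bool}.

Let E0 : (0 < #|E|)%N.
Proof. by apply/card_gt0P; exists [ffun=> false]. Qed.

Let fam (X : 'I_N -> 'I_N -> {RV P >-> R}) (ij : 'I_N * 'I_N) := X ij.1 ij.2.

Let L c (X : 'I_N -> 'I_N -> {RV P >-> R}) (w : T) : R :=
  log_partition (@both_selected N) c ((fam X)^~ w).

Let integrable_L c (X : 'I_N -> 'I_N -> {RV P >-> R}) :
  standardized X -> P.-integrable setT (EFin \o L c X).
Proof. by move=> sX; apply: integrable_log_partition => // ij; exact: sX. Qed.

Let integrable_cst (r : R) : P.-integrable setT (EFin \o (cst r : T -> R)).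
Proof. exact: finite_measure_integrable_cst. Qed.

(** Soft approximation at b = 1 places [s * opt] within N of an integrable log-partition function,
    and |s| = 1. *)
Let integrable_opt (X : 'I_N -> 'I_N -> {RV P >-> R}) : standardized X ->
  P.-integrable setT (EFin \o (fun w => opt (fun i j => X i j w))).
Proof.
move=> sX; set c := s * 1 / Num.sqrt N%:R.
apply: (@integrable_le_norm _ _ _ _ _ (fun w => `|L c X w| + N%:R)) => //.
  have := integrableD measurableT (integrable_norm (integrable_L c sX))
    (integrable_cst N%:R).
  by apply: eq_integrable => // w _; rewrite /= EFinD.
move=> w; have := sopt (fun i j => X i j w) (@ltr01 R).
rewrite -/c -/(L c X w) mulr1 => h.
have -> : `|opt (fun i j => X i j w)| = `|s * opt (fun i j => X i j w)|.
  by rewrite normrM s1 mul1r.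
rewrite -lerBlDl; apply: le_trans h.
by rewrite distrC; exact: lerB_dist.
Qed.

Let Rintegral_opt b (X : 'I_N -> 'I_N -> {RV P >-> R}) :
  0 < b -> standardized X ->
  `|\int[P]_w L (s * b / Num.sqrt N%:R) X w
    - s * b * \int[P]_w opt (fun i j => X i j w)| <= N%:R.
Proof.
move=> b0 sX; set c := s * b / _.
have iO := integrable_opt sX.
have iO' : P.-integrable setT
    (EFin \o (fun w => s * b * opt (fun i j => X i j w))).
  have := integrableZl measurableT (s * b) iO.
  by apply: eq_integrable => // w _; rewrite /= EFinM.
have iD : P.-integrable setT
    (EFin \o (fun w => L c X w - s * b * opt (fun i j => X i j w))).
  have := integrableB measurableT (integrable_L c sX) iO'.
  by apply: eq_integrable => // w _; rewrite /= EFinB.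
rewrite -RintegralZl// -RintegralB//; last exact: integrable_L.
apply: le_trans (le_normr_Rintegral measurableT iD) _.
apply: (@le_trans _ _ (\int[P]_w (cst N%:R w))).
  apply: le_Rintegral => //; first exact: integrable_norm.
  by move=> w _; exact: sopt.
by rewrite Rintegral_cst//= probability_setT/= mulr1.
Qed.

(** Passing to the log-partition function costs N for each of [J] and [Y], the replacement costs the
    sum; everything is then divided by N b. *)
Lemma mean_gap_le_min23 b : 0 < b -> (mean_gap <=
  (2 / b + (N%:R * b)^-1 * \sum_(ij : 'I_N * 'I_N)
    (\int[P]_w min23 (s * b / Num.sqrt N%:R * J ij.1 ij.2 w)
     + \int[P]_w min23 (s * b / Num.sqrt N%:R * Y ij.1 ij.2 w)))%:E)%E.
Proof.
move=> b0; have [indJ indY indJY sJ sY] := JY.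
have nN0 : 0 < N%:R :> R by rewrite ltr0n.
rewrite /mean_gap !expectation_Rintegral; [|exact: integrable_opt..].
rewrite -EFinB /abse -EFinM lee_fin.
set c := s * b / _.
have rep := log_partition_replacement (@both_selected N) c E0 (J := fam J)
  (Y := fam Y)
  (fun ij => sJ _ _) (fun ij => sY _ _) indJ indY indJY.
have aJ := Rintegral_opt b0 sJ; have aY := Rintegral_opt b0 sY.
move: rep aJ aY; rewrite -/c.
set S := \sum_ij _.
set A := \int[P]_w opt _; set B := \int[P]_w opt _.
set C := \int[P]_w L c J w; set D := \int[P]_w L c Y w.
move=> rep aJ aY.
have : `|s * b * (A - B)| <= 2 * N%:R + S.
  move: rep aJ aY.
  rewrite mulrBr !ler_norml => /andP[? ?] /andP[? ?] /andP[? ?].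
  by apply/andP; split; lra.
rewrite !normrM s1 mul1r (gtr0_norm b0) -ler_pdivlMl// => AB.
rewrite -(ler_pM2l nN0) mulrA divff ?gt_eqF// mul1r (le_trans AB)//.
by rewrite le_eqVlt; apply/orP; left; apply/eqP; field; rewrite !gt_eqF.
Qed.

End gap.

(** * Moment bounds on the Taylor remainder *)

Section min23_bounds.
Context (R : realType) (d : measure_display) (T : measurableType d).
Variables (P : probability T R) (X : {RV P >-> R}) (c : R).
Hypothesis X2 : ('E_P[fun w => (X w ^+ 2)%R] = 1)%E.

Lemma Rintegral_min23_le_third_moment g :
  ('E_P[fun w => (`|X w| ^+ 3)%R] <= g%:E)%E ->
  \int[P]_w min23 (c * X w) <= `|c| ^+ 3 * g.
Proof.
rewrite unlock => X3g.
have mX3 : measurable_fun [set: T] (fun w => `|X w| ^+ 3).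
  by apply: measurable_funX; exact: measurableT_comp.
have iX3 : P.-integrable setT (EFin \o (fun w => `|X w| ^+ 3)).
  apply/integrableP; split; first exact/measurable_EFinP.
  under eq_integral do rewrite /= ger0_norm ?exprn_ge0//.
  by rewrite (le_lt_trans X3g)// ltry.
have iX3c : P.-integrable setT (EFin \o (fun w => `|c| ^+ 3 * `|X w| ^+ 3)).
  have := integrableZl measurableT (`|c| ^+ 3) iX3.
  by apply: eq_integrable => // w _; rewrite /= EFinM.
apply: (@le_trans _ _ (\int[P]_w (`|c| ^+ 3 * `|X w| ^+ 3))).
  apply: le_Rintegral => //; first exact: integrable_min23.
  by move=> w _; rewrite /min23 ge_min normrM !exprMn lexx orbT.
rewrite RintegralZl// ler_wpM2l ?exprn_ge0// -lee_fin fineK//.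
exact: integrable_fin_num.
Qed.

Lemma integrable_truncated_sqr (D : set T) : measurable D ->
  P.-integrable setT (EFin \o ((fun w => X w ^+ 2) \_ D)).
Proof.
move=> mD; apply: integrable_le_norm (integrable_sqr X2) _.
  apply/(measurable_restrictT _ mD).
  exact/measurable_funTS/measurable_funX.
move=> w; rewrite /patch; case: ifP; rewrite ?normr0 ?sqr_ge0//.
by rewrite ger0_norm ?sqr_ge0.
Qed.

Lemma measurable_norm_gt (delta : R) :
  measurable [set w | delta < `|X w|].
Proof.
have mn : measurable_fun [set: T] (fun w => `|X w|) by exact: measurableT_comp.
rewrite [X in measurable X](_ : _ =
  (fun w => `|X w|) @^-1` `]delta, +oo[%classic).
  by rewrite -[X in measurable X]setTI; exact: mn.
by apply/seteqP; split => w /=; rewrite in_itv/= andbT.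
Qed.

(** The square is used where |X| > delta; elsewhere |X|^3 <= delta X^2, whose mean is at most
    delta. *)
Lemma Rintegral_min23_le_truncation delta : 0 <= delta ->
  \int[P]_w min23 (c * X w) <= `|c| ^+ 3 * delta
    + `|c| ^+ 2 * \int[P]_(w in [set w | delta < `|X w|]) (X w ^+ 2).
Proof.
move=> delta0; set D := [set w | delta < `|X w|].
have mD : measurable D by exact: measurable_norm_gt.
have iX2 := integrable_sqr X2.
have iX2D := integrable_truncated_sqr mD.
have iZ f r : P.-integrable setT (EFin \o f) ->
    P.-integrable setT (EFin \o (fun w => r * f w)).
  move=> fi; have := integrableZl measurableT r fi.
  by apply: eq_integrable => // w _; rewrite /= EFinM.
have i1 := iZ _ (`|c| ^+ 3 * delta) iX2.
have i2 := iZ _ (`|c| ^+ 2) iX2D.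
(* A factor 1 is written as the integral of X^2, so that the two sides can be compared pointwise. *)
rewrite (Rintegral_mkcond _ D) -[X in X + _]mulr1 -(Rintegral_sqr X2).
rewrite -!RintegralZl// -RintegralD//.
apply: le_Rintegral => //; first exact: integrable_min23.
  have := integrableD measurableT i1 i2.
  by apply: eq_integrable => // w _; rewrite /= EFinD.
move=> w _; rewrite /min23 /patch ge_min normrM !exprMn.
case: ifPn => [_|].
  apply/orP; left; rewrite (real_normK (num_real (X w))) lerDr.
  by apply: mulr_ge0; [apply: mulr_ge0; [exact: exprn_ge0|]|exact: sqr_ge0].
rewrite notin_setE /D /= => /negP; rewrite -leNgt => Xd.
apply/orP; right; rewrite mulr0 addr0 -(mulrA _ delta) ler_wpM2l ?exprn_ge0//.
by rewrite exprS (real_normK (num_real (X w))) ler_wpM2r ?sqr_ge0.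
Qed.

End min23_bounds.

(** * Gap bounds from third moments and from truncation *)

Section gap_rates.
Context (R : realType) (d : measure_display) (T : measurableType d).
Context (P : probability T R) (N : nat) (J Y : 'I_N -> 'I_N -> {RV P >-> R}).
Hypotheses (N0 : (0 < N)%N) (JY : couplings J Y).
Variables (s : R) (opt : ('I_N -> 'I_N -> R) -> R).
Hypotheses (s1 : `|s| = 1) (sopt : softly_approximated s opt).
Hypothesis mopt : forall X : 'I_N -> 'I_N -> {RV P >-> R},
  measurable_fun [set: T] (fun w => opt (fun i j => X i j w)).

Let sqrtN_gt0 : 0 < Num.sqrt N%:R :> R.
Proof. by rewrite sqrtr_gt0 ltr0n. Qed.

Let sqr_sqrtN : Num.sqrt N%:R ^+ 2 = N%:R :> R.
Proof. by rewrite sqr_sqrtr. Qed.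

Let norm_coef b : 0 < b ->
  `|s * b / Num.sqrt N%:R| = b / Num.sqrt N%:R.
Proof.
by move=> b0; rewrite !normrM s1 mul1r normfV !gtr0_norm.
Qed.

Lemma third_moment_le_gamma (i j : 'I_N) :
  ('E_P[fun w => (`|J i j w| ^+ 3)%R] <= gamma J Y)%E /\
  ('E_P[fun w => (`|Y i j w| ^+ 3)%R] <= gamma J Y)%E.
Proof.
by split; rewrite /gamma; apply: (bigmax_sup (i, j)) => //=;
  rewrite le_max lexx ?orbT.
Qed.

Lemma mean_gap_le_gamma : (gamma J Y < +oo)%E ->
  (mean_gap J Y opt <=
   ((2 + 2 * fine (gamma J Y)) * N%:R `^ (- (6%:R)^-1))%R%:E)%E.
Proof.
move=> gfin; set g := fine _.
have g0 : (0 <= gamma J Y)%E by exact: bigmax_ge_id.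
have gE : gamma J Y = g%:E by rewrite fineK// ge0_fin_numE.
(* The bound obtained is 2 / b + 2 g b^2 / sqrt N; both terms have the same order when b^3 = sqrt
   N. *)
pose b : R := N%:R `^ (6%:R)^-1.
have nN0 : 0 < N%:R :> R by rewrite ltr0n.
have b0 : 0 < b by exact: powR_gt0.
have b3 : b ^+ 3 = Num.sqrt N%:R.
  rewrite -powR_mulrn ?ltW// /b -powRrM -powR12_sqrt ?ler0n//.
  by congr (_ `^ _); field.
have NE : N%:R = b ^+ 6 by rewrite -sqr_sqrtN -b3 -exprM.
have [_ _ _ sJ sY] := JY.
apply: le_trans (mean_gap_le_min23 N0 JY s1 sopt mopt b0) _; rewrite lee_fin.
have -> : N%:R `^ (- (6%:R)^-1) = b^-1 :> R by rewrite powRN.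
apply: (@le_trans _ _ (2 / b + (N%:R * b)^-1 *
    \sum_(ij : 'I_N * 'I_N) (2 * (b / Num.sqrt N%:R) ^+ 3 * g))).
  rewrite lerD2l ler_wpM2l ?invr_ge0 ?mulr_ge0 ?(ltW b0)//.
  apply: ler_sum => -[i j] _ /=; have [Jg Yg] := third_moment_le_gamma i j.
  rewrite -(norm_coef b0).
  set c3 := `|_| ^+ 3; have -> : 2 * c3 * g = c3 * g + c3 * g by ring.
  apply: lerD.
    by apply: Rintegral_min23_le_third_moment; [case: (sJ i j)|rewrite -gE].
  by apply: Rintegral_min23_le_third_moment; [case: (sY i j)|rewrite -gE].
rewrite sumr_const card_prod card_ord -[_ *+ (N * N)]mulr_natl natrM -b3 NE.
by rewrite le_eqVlt; apply/orP; left; apply/eqP; field; rewrite gt_eqF.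
Qed.

(** Unit variance makes every truncated moment finite, so the computation can be carried out in the
    reals. *)
Lemma truncated_second_momentE (X : 'I_N -> 'I_N -> {RV P >-> R}) eps :
  standardized X -> truncated_second_moment X eps =
  ((N%:R ^+ 2)^-1 * \sum_(ij : 'I_N * 'I_N)
    \int[P]_(w in [set w | (eps * Num.sqrt N%:R < `|X ij.1 ij.2 w|)%R])
      (X ij.1 ij.2 w ^+ 2))%:E.
Proof.
move=> sX; rewrite /truncated_second_moment pair_big/= EFinM -sumEFin.
congr (_ * _)%E; apply: eq_bigr => -[i j] _ /=; rewrite /Rintegral fineK//.
have [_ X2] := sX i j; apply: integrable_fin_num => //.
  exact: measurable_norm_gt.
apply: (integrableS measurableT) => //; first exact: measurable_norm_gt.
exact: integrable_sqr.
Qed.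

(** Each entry is truncated at eps sqrt N with c = s b / sqrt N. After summing N^2 entries and
    dividing by N b, the small values contribute 2 b^2 eps and the large ones b times the truncated
    moments. *)
Lemma mean_gap_le_truncation b eps : 0 < b -> 0 < eps ->
  (mean_gap J Y opt <= (2 / b + 2 * b ^+ 2 * eps)%:E + b%:E *
    (truncated_second_moment J eps + truncated_second_moment Y eps))%E.
Proof.
move=> b0 eps0; have [_ _ _ sJ sY] := JY.
have nN0 : 0 < N%:R :> R by rewrite ltr0n.
apply: le_trans (mean_gap_le_min23 N0 JY s1 sopt mopt b0) _.
rewrite !truncated_second_momentE// -EFinD lee_fin.
set r := Num.sqrt N%:R.
pose tau (X : 'I_N -> 'I_N -> {RV P >-> R}) (ij : 'I_N * 'I_N) :=
  \int[P]_(w in [set w | eps * r < `|X ij.1 ij.2 w|]) (X ij.1 ij.2 w ^+ 2).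
rewrite -/(tau J) -/(tau Y).
apply: (@le_trans _ _ (2 / b + (N%:R * b)^-1 *
    \sum_(ij : 'I_N * 'I_N) (2 * (b / r) ^+ 3 * (eps * r)
      + (b / r) ^+ 2 * (tau J ij + tau Y ij)))).
  rewrite lerD2l ler_wpM2l ?invr_ge0 ?mulr_ge0 ?(ltW b0)//.
  apply: ler_sum => -[i j] _ /=.
  have d0 : 0 <= eps * r by rewrite mulr_ge0 ?ltW.
  have [_ J2] := sJ i j; have [_ Y2] := sY i j.
  have := Rintegral_min23_le_truncation (s * b / r) J2 d0.
  have := Rintegral_min23_le_truncation (s * b / r) Y2 d0.
  rewrite norm_coef// -/(tau J (i, j)) -/(tau Y (i, j)) => h1 h2.
  apply: le_trans (lerD h2 h1) _.
  by rewrite le_eqVlt; apply/orP; left; apply/eqP; ring.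
rewrite big_split/= sumr_const card_prod card_ord -mulr_sumr big_split/=.
rewrite -[_ *+ (N * N)]mulr_natl natrM -sqr_sqrtN -/r.
have r0 : r != 0 by rewrite gt_eqF.
by rewrite le_eqVlt; apply/orP; left; apply/eqP; field; rewrite r0 gt_eqF.
Qed.

End gap_rates.

(** * Passage to the limit under Lindeberg's condition *)

Lemma cvge0_of_truncation (R : realType) (g : nat -> \bar R)
    (L : R -> nat -> \bar R) :
  (forall n, 0 <= g n)%E ->
  (forall eps, 0 < eps -> L eps @ \oo --> 0%E) ->
  (forall n b eps, (0 < n)%N -> 0 < b -> 0 < eps ->
     (g n <= (2 / b + 2 * b ^+ 2 * eps)%:E + b%:E * L eps n)%E) ->
  g @ \oo --> 0%E.
Proof.
move=> g0 L0 gL.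
have small e : 0 < e -> \forall n \near \oo, (g n <= e%:E)%E.
  (* These choices make 2 / b and 2 b^2 eps equal to e / 4 each; for n large, the term in [L] takes
     the remaining e / 2. *)
  move=> e0; pose b := 8 / e; pose eps := e / (8 * b ^+ 2).
  have b0 : 0 < b by rewrite divr_gt0.
  have eps0 : 0 < eps by rewrite divr_gt0// mulr_gt0// exprn_gt0.
  have /fine_cvgP[Lfin /cvgrPdist_le Lle] := L0 _ eps0.
  have eb0 : 0 < e / (2 * b) by rewrite divr_gt0// mulr_gt0.
  near=> n.
  have n0 : (0 < n)%N by near: n; exists 1%N.
  apply: le_trans (gL n b eps n0 b0 eps0) _.
  have Ln : L eps n \is a fin_num by near: n.
  have Ls : `|0 - fine (L eps n)| <= e / (2 * b) by near: n; exact: Lle.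
  rewrite -(fineK Ln) -EFinM -EFinD lee_fin.
  have : b * fine (L eps n) <= e / 2.
    rewrite mulrC -ler_pdivlMr// -mulrA -invfM; apply: le_trans Ls.
    by rewrite sub0r normrN ler_norm.
  have -> : 2 / b + 2 * b ^+ 2 * eps = e / 2.
    by rewrite /eps /b; field; rewrite gt_eqF.
  lra.
(* Convergence to 0 in the extended reals means eventual finiteness and convergence of the real
   parts; nonnegativity of [g] with [small] gives both. *)
apply/fine_cvgP; split.
  have := small 1 ltr01; apply: filterS => n gn1.
  by rewrite ge0_fin_numE// (le_lt_trans gn1)// ltry.
apply/cvgrPdist_le => e e0; have := small e e0; apply: filterS => n gne.
rewrite sub0r normrN ger0_norm ?fine_ge0//.
rewrite -lee_fin fineK// ge0_fin_numE//.
by rewrite (le_lt_trans gne)// ltry.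
Unshelve. all: by end_near. Qed.

Lemma mean_gap_ge0 (R : realType) (d : measure_display) (T : measurableType d)
    (P : probability T R) (N : nat) (J Y : 'I_N -> 'I_N -> {RV P >-> R})
    (opt : ('I_N -> 'I_N -> R) -> R) : (0 <= mean_gap J Y opt)%E.
Proof. by rewrite /mean_gap mule_ge0// lee_fin invr_ge0. Qed.

Lemma cvg_mean_gap (R : realType) (d : nat -> measure_display)
    (T : forall N : nat, measurableType (d N))
    (P : forall N : nat, probability (T N) R)
    (J Y : forall N : nat, 'I_N -> 'I_N -> {RV (P N) >-> R})
    (s : R) (opt : forall N, ('I_N -> 'I_N -> R) -> R) :
  `|s| = 1 -> (forall N, softly_approximated s (opt N)) ->
  (forall N (X : 'I_N -> 'I_N -> {RV (P N) >-> R}),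
     measurable_fun [set: T N] (fun w => opt N (fun i j => X i j w))) ->
  (forall N : nat, (1 <= N)%N -> couplings (J N) (Y N)) ->
  lindeberg J -> lindeberg Y ->
  (fun N : nat => mean_gap (J N) (Y N) (opt N)) @ \oo --> 0%E.
Proof.
move=> s1 sopt mopt JY LJ LY.
apply: (@cvge0_of_truncation _ _ (fun eps N => truncated_second_moment (J N) eps
  + truncated_second_moment (Y N) eps)%E).
- by move=> N; exact: mean_gap_ge0.
- move=> eps eps0; rewrite -(adde0 0%E).
  by apply: cvgeD; [|exact: LJ|exact: LY].
- by move=> N b eps N0 b0 eps0; apply: (mean_gap_le_truncation N0 (JY N N0) s1).
Qed.

Theorem theorem2p3 (R : realType) :
  (forall (d : nat -> measure_display) (T : forall N : nat, measurableType (d N))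
      (P : forall N : nat, probability (T N) R)
      (J Y : forall N : nat, 'I_N -> 'I_N -> {RV (P N) >-> R}),
      (forall N : nat, (1 <= N)%N -> couplings (J N) (Y N)) ->
      lindeberg J -> lindeberg Y ->
      ((fun N : nat => min_gap (J N) (Y N)) @ \oo --> 0%E) /\
      ((fun N : nat => max_gap (J N) (Y N)) @ \oo --> 0%E))
  /\
  (exists C : R -> R,
    forall (N : nat) (d : measure_display) (T : measurableType d)
      (P : probability T R) (J Y : 'I_N -> 'I_N -> {RV P >-> R}),
      (1 <= N)%N -> couplings J Y -> (gamma J Y < +oo)%E ->
      (min_gap J Y <= (C (fine (gamma J Y)) * N%:R `^ (- (6%:R)^-1))%R%:E)%E /\
      (max_gap J Y <= (C (fine (gamma J Y)) * N%:R `^ (- (6%:R)^-1))%R%:E)%E).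
Proof.
have s1 : `|1| = 1 :> R by exact: normr1.
have sN1 : `|- 1| = 1 :> R by exact: normrN1.
split=> [d T P J Y JY LJ LY|].
  split.
    apply: (cvg_mean_gap (opt := fun N => @minH R N) sN1) => //.
      by move=> N; exact: softly_approximated_minH.
    by move=> N X; exact: measurable_minH.
  apply: (cvg_mean_gap (opt := fun N => @maxH R N) s1) => //.
    by move=> N; exact: softly_approximated_maxH.
  by move=> N X; exact: measurable_maxH.
(* The 2 comes from the two soft approximations, and 2 g from the cubic remainders of [J] and
   [Y]. *)
exists (fun g => 2 + 2 * g) => N d T P J Y N0 JY gfin; split.
  apply: (mean_gap_le_gamma N0 JY sN1 (opt := @minH R N)) => //.
    exact: softly_approximated_minH.
  by move=> X; exact: measurable_minH.
apply: (mean_gap_le_gamma N0 JY s1 (opt := @maxH R N)) => //.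
  exact: softly_approximated_maxH.
by move=> X; exact: measurable_maxH.
Qed.
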